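(* Let $\Gamma\cup\{\varphi\}\subseteq\mathcal{L}$. Then $\Gamma\models\varphi$ implies $\Gamma\vdash\varphi$ (in $\mathbf{mb}^\bigstar$).
   Context: Let $V$ be a denumerable set of propositional variables and let $\mathcal{L}$ be the set of formulas generated freely from $V$ by the binary connectives $\land,\lor,\longrightarrow$ and the unary connectives $\neg,\bigstar$. The logic $\mathbf{mb}^\bigstar=\langle\mathcal{L},\vdash\rangle$ is given by the Hilbert-style system with the following axiom schemas (for all $\alpha,\beta,\gamma\in\mathcal{L}$): (1) $\alpha\longrightarrow(\beta\longrightarrow\alpha)$; (2) $(\alpha\longrightarrow\beta)\longrightarrow((\alpha\longrightarrow(\beta\longrightarrow\gamma))\longrightarrow(\alpha\longrightarrow\gamma))$; (3) $\alpha\longrightarrow(\beta\longrightarrow(\alpha\land\beta))$; (4) $(\alpha\land\beta)\longrightarrow\alpha$; (5) $(\alpha\land\beta)\longrightarrow\beta$; (6) $\alpha\longrightarrow(\alpha\lor\beta)$; (7) $\beta\longrightarrow(\alpha\lor\beta)$; (8) $(\alpha\longrightarrow\gamma)\longrightarrow((\beta\longrightarrow\gamma)\longrightarrow((\alpha\lor\beta)\longrightarrow\gamma))$; (9) $\alpha\lor(\alpha\longrightarrow\beta)$; (10) $\alpha\longrightarrow(\neg\alpha\longrightarrow\beta)$; (11) $(\alpha\lor\neg\alpha)\lor\bigstar\alpha$; and the single inference rule modus ponens (from $\alpha$ and $\alpha\longrightarrow\beta$ infer $\beta$). For $\Gamma\cup\{\varphi\}\subseteq\mathcal{L}$, $\Gamma\vdash\varphi$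 means there is a finite sequence of formulas ending in $\varphi$, each of which is an axiom instance, an element of $\Gamma$, or obtained from two earlier members by modus ponens. An $\mathbf{mb}^\bigstar$-valuation is a function $v:\mathcal{L}\to\{0,1\}$ such that for all $\alpha,\beta\in\mathcal{L}$: (i) $v(\alpha\lor\beta)=1$ iff $v(\alpha)=1$ or $v(\beta)=1$; (ii) $v(\alpha\land\beta)=1$ iff $v(\alpha)=1$ and $v(\beta)=1$; (iii) $v(\alpha\longrightarrow\beta)=1$ iff $v(\alpha)=0$ or $v(\beta)=1$; (iv) if $v(\alpha)=1$ then $v(\neg\alpha)=0$; (v) if $v(\alpha)=0=v(\neg\alpha)$ then $v(\bigstar\alpha)=1$. $\Gamma\models\varphi$ means that for every $\mathbf{mb}^\bigstar$-valuation $v$, $v(\varphi)=1$ whenever $v(\gamma)=1$ for every $\gamma\in\Gamma$. *)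

(* Defs.v *)
From Stdlib Require Import List FinFun.
Import ListNotations.

Set Implicit Arguments.

Definition denumerable (V : Type) : Prop :=
  exists f : nat -> V, Bijective f.

Inductive formula (V : Type) : Type :=
| Var (p : V)
| And (a b : formula V)
| Or (a b : formula V)
| Imp (a b : formula V)
| Neg (a : formula V)
| Star (a : formula V).

Declare Scope mb_scope.
Delimit Scope mb_scope with mb.
Bind Scope mb_scope with formula.

Notation "a ∧' b" := (And a b) (at level 40, left associativity) : mb_scope.
Notation "a ∨' b" := (Or a b) (at level 50, left associativity) : mb_scope.
Notation "a ⟶ b" := (Imp a b) (at level 60, right associativity) : mb_scope.
Notation "¬' a" := (Neg a) (at level 35, right associativity) : mb_scope.
Notation "★ a" := (Star a) (at level 35, right associativity) : mb_scope.

Local Open Scope mb_scope.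

Inductive axiom (V : Type) : formula V -> Prop :=
| Ax1 a b : axiom (a ⟶ (b ⟶ a))
| Ax2 a b c : axiom ((a ⟶ b) ⟶ ((a ⟶ (b ⟶ c)) ⟶ (a ⟶ c)))
| Ax3 a b : axiom (a ⟶ (b ⟶ (a ∧' b)))
| Ax4 a b : axiom ((a ∧' b) ⟶ a)
| Ax5 a b : axiom ((a ∧' b) ⟶ b)
| Ax6 a b : axiom (a ⟶ (a ∨' b))
| Ax7 a b : axiom (b ⟶ (a ∨' b))
| Ax8 a b c : axiom ((a ⟶ c) ⟶ ((b ⟶ c) ⟶ ((a ∨' b) ⟶ c)))
| Ax9 a b : axiom (a ∨' (a ⟶ b))
| Ax10 a b : axiom (a ⟶ (¬' a ⟶ b))
| Ax11 a : axiom ((a ∨' ¬' a) ∨' ★ a).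

Definition derivation (V : Type) (Gamma : formula V -> Prop)
    (l : list (formula V)) : Prop :=
  forall (i : nat) (b : formula V), nth_error l i = Some b ->
    axiom b \/ Gamma b \/
    exists (j k : nat) (a : formula V),
      j < i /\ k < i /\
      nth_error l j = Some a /\ nth_error l k = Some (a ⟶ b).

Definition derives (V : Type) (Gamma : formula V -> Prop)
    (phi : formula V) : Prop :=
  exists l : list (formula V), derivation Gamma (l ++ [phi]).

Record valuation (V : Type) (v : formula V -> bool) : Prop := {
  val_or : forall a b, v (a ∨' b) = true <-> v a = true \/ v b = true;
  val_and : forall a b, v (a ∧' b) = true <-> v a = true /\ v b = true;
  val_imp : forall a b, v (a ⟶ b) = true <-> v a = false \/ v b = true;
  val_neg : forall a, v a = true -> v (¬' a) = false;
  val_star : forall a, v a = false -> v (¬' a) = false -> v (★ a) = true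
}.

Definition entails (V : Type) (Gamma : formula V -> Prop)
    (phi : formula V) : Prop :=
  forall v : formula V -> bool, valuation v ->
    (forall g, Gamma g -> v g = true) -> v phi = true.

(* Main.v *)
From Stdlib Require Import List Lia Arith FinFun Cantor Classical ClassicalEpsilon.
Require Import Defs.
Import ListNotations.
Local Open Scope mb_scope.

(** If [phi] is not derivable from [Gamma], a Lindenbaum construction along an
    injective coding of formulas by natural numbers extends [Gamma] to a set that
    is maximal among those not deriving [phi].  Such a set is deductively closed
    and prime (axiom 8), and so its characteristic function is a valuation: axioms 9
    and 11 together with primeness give the clauses for implication and [★],
    and axiom 10 the one for negation.  This valuation satisfies [Gamma] but
    not [phi]. *)

Lemma derivation_app {V : Type} (Gamma : formula V -> Prop) l1 l2 :
  derivation Gamma l1 -> derivation Gamma l2 -> derivation Gamma (l1 ++ l2).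
Proof.
  intros H1 H2 i b Hi.
  destruct (Nat.lt_ge_cases i (length l1)) as [Hlt | Hge].
  - rewrite nth_error_app1 in Hi by assumption.
    destruct (H1 i b Hi) as [H | [H | (j & k & a & Hj & Hk & Ea & Eab)]]; auto.
    right; right; exists j, k, a.
    rewrite !nth_error_app1 by lia; auto.
  - rewrite nth_error_app2 in Hi by assumption.
    destruct (H2 _ b Hi) as [H | [H | (j & k & a & Hj & Hk & Ea & Eab)]]; auto.
    right; right; exists (length l1 + j), (length l1 + k), a.
    rewrite !nth_error_app2 by lia.
    replace (length l1 + j - length l1) with j by lia.
    replace (length l1 + k - length l1) with k by lia.
    repeat split; auto; lia.
Qed.

Lemma derivation_snoc {V : Type} (Gamma : formula V -> Prop) l b :
  derivation Gamma l ->
  (axiom b \/ Gamma b \/ exists a, In a l /\ In (a ⟶ b) l) ->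
  derivation Gamma (l ++ [b]).
Proof.
  intros Hl Hb i c Hi.
  destruct (Nat.lt_ge_cases i (length l)) as [Hlt | Hge].
  - rewrite nth_error_app1 in Hi by assumption.
    destruct (Hl i c Hi) as [H | [H | (j & k & a & Hj & Hk & Ea & Eab)]]; auto.
    right; right; exists j, k, a.
    rewrite !nth_error_app1 by lia; auto.
  - rewrite nth_error_app2 in Hi by assumption.
    assert (c = b) as ->.
    { apply nth_error_In in Hi; destruct Hi as [E | []]; auto. }
    destruct Hb as [H | [H | (a & Ha & Hab)]]; auto.
    right; right.
    apply In_nth_error in Ha as [j Ej].
    apply In_nth_error in Hab as [k Ek].
    assert (j < length l) by (apply nth_error_Some; congruence).
    assert (k < length l) by (apply nth_error_Some; congruence).
    exists j, k, a.
    rewrite !nth_error_app1 by assumption.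
    repeat split; auto; lia.
Qed.

(** Tree-shaped proofs, which allow structural induction without index bookkeeping; [proves_derives]
    flattens them into sequences. *)
Inductive proves {V : Type} (Gamma : formula V -> Prop) : formula V -> Prop :=
| proves_axiom a : axiom a -> proves Gamma a
| proves_hyp a : Gamma a -> proves Gamma a
| proves_mp a b : proves Gamma (a ⟶ b) -> proves Gamma a -> proves Gamma b.

Arguments proves_axiom {V Gamma a}.
Arguments proves_hyp {V Gamma a}.
Arguments proves_mp {V Gamma a b}.

Lemma proves_derives {V : Type} (Gamma : formula V -> Prop) phi :
  proves Gamma phi -> derives Gamma phi.
Proof.
  assert (Hnil : derivation Gamma []) by (intros [] ? ?; discriminate).
  induction 1 as [a Ha | a Ha | a b _ [l1 IH1] _ [l2 IH2]].
  - exists []; apply derivation_snoc; auto.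
  - exists []; apply derivation_snoc; auto.
  - exists ((l1 ++ [a ⟶ b]) ++ (l2 ++ [a])).
    apply derivation_snoc; [now apply derivation_app |].
    right; right; exists a; split; rewrite !in_app_iff; simpl; auto.
Qed.

Definition add {V : Type} (Gamma : formula V -> Prop) (a b : formula V) : Prop :=
  Gamma b \/ b = a.

Lemma proves_weaken {V : Type} {Gamma Delta : formula V -> Prop} {phi} :
  (forall a, Gamma a -> Delta a) -> proves Gamma phi -> proves Delta phi.
Proof.
  intros Hsub; induction 1; eauto using proves.
Qed.

Lemma proves_refl {V : Type} (Gamma : formula V -> Prop) a :
  proves Gamma (a ⟶ a).
Proof.
  (* The instance of [Ax2] with middle formula [a ⟶ a] and last formula [a]; both its premises are
     instances of [Ax1]. *)
  apply (proves_mp (a := a ⟶ (a ⟶ a) ⟶ a)); [| apply proves_axiom, Ax1].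
  apply (proves_mp (a := a ⟶ a ⟶ a)); apply proves_axiom; constructor.
Qed.

(** Modus ponens is the only rule: [Ax1] prefixes [a] to axioms and hypotheses, and [Ax2] carries
    the prefix through modus ponens. *)
Lemma deduction {V : Type} {Gamma : formula V -> Prop} {a b} :
  proves (add Gamma a) b -> proves Gamma (a ⟶ b).
Proof.
  induction 1 as [c Hc | c [Hc | ->] | c d _ IH1 _ IH2].
  - exact (proves_mp (proves_axiom (Ax1 c a)) (proves_axiom Hc)).
  - exact (proves_mp (proves_axiom (Ax1 c a)) (proves_hyp Hc)).
  - apply proves_refl.
  - exact (proves_mp (proves_mp (proves_axiom (Ax2 a c d)) IH2) IH1).
Qed.

(** Compactness: a proof uses finitely many hypotheses, so all of them already lie in one stage of
    the increasing chain. *)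
Lemma proves_chain_union {V : Type} (E : nat -> formula V -> Prop) phi :
  (forall n a, E n a -> E (S n) a) ->
  proves (fun a => exists n, E n a) phi -> exists n, proves (E n) phi.
Proof.
  intros HS.
  assert (Hmono : forall m n, m <= n -> forall a, E m a -> E n a).
  { induction 1; auto. }
  induction 1 as [a Ha | a [n Ha] | a b _ [m IH1] _ [n IH2]].
  - exists 0; now apply proves_axiom.
  - exists n; now apply proves_hyp.
  - exists (max m n); apply (proves_mp (a := a)).
    + apply (proves_weaken (Hmono m (max m n) (Nat.le_max_l m n)) IH1).
    + apply (proves_weaken (Hmono n (max m n) (Nat.le_max_r m n)) IH2).
Qed.

Fixpoint code {V : Type} (g : V -> nat) (a : formula V) : nat :=
  to_nat match a with
  | Var p => (0, g p)
  | a ∧' b => (1, to_nat (code g a, code g b))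
  | a ∨' b => (2, to_nat (code g a, code g b))
  | a ⟶ b => (3, to_nat (code g a, code g b))
  | ¬' a => (4, code g a)
  | ★ a => (5, code g a)
  end.

Local Arguments to_nat : simpl never.

Lemma code_inj {V : Type} (g : V -> nat) :
  Injective g -> Injective (code g).
Proof.
  intros Hg a; induction a; intros []; simpl; intros E;
    apply to_nat_inj in E; try discriminate E;
    injection E as E; f_equal; auto;
    apply to_nat_inj in E; injection E as E1 E2; auto.
Qed.

Lemma formula_code {V : Type} :
  denumerable V -> exists c : formula V -> nat, Injective c.
Proof.
  intros (f & g & _ & Hfg).
  exists (code g); apply code_inj.
  intros x y E; rewrite <- (Hfg x), <- (Hfg y); now f_equal.
Qed.

(** Stage [S n] treats the formula with code [n]. Testing [c a = n] avoids decoding: if [n] codes no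
    formula, nothing is added. *)
Fixpoint lindenbaum {V : Type} (c : formula V -> nat) (Gamma : formula V -> Prop)
    (phi : formula V) (n : nat) : formula V -> Prop :=
  match n with
  | 0 => Gamma
  | S n => fun a => lindenbaum c Gamma phi n a \/
      (c a = n /\ ~ proves (add (lindenbaum c Gamma phi n) a) phi)
  end.

Lemma lindenbaum_unprovable {V : Type} (c : formula V -> nat) {Gamma phi} n :
  Injective c -> ~ proves Gamma phi -> ~ proves (lindenbaum c Gamma phi n) phi.
Proof.
  intros Hc Hphi; induction n as [| n IHn]; simpl; [assumption |]; intros H.
  (* Either some [a] is added, and by injectivity of [c] it is the only new formula, or the stage is
     unchanged. *)
  destruct (classic (exists a, c a = n /\
    ~ proves (add (lindenbaum c Gamma phi n) a) phi)) as [(a & Ea & Ha) | Hno].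
  - apply Ha; revert H; apply proves_weaken.
    intros b [Hb | [Eb _]]; [now left | right; apply Hc; congruence].
  - apply IHn; revert H; apply proves_weaken.
    intros b [Hb | Hb]; [assumption | exfalso; eauto].
Qed.

Lemma maximal_extension {V : Type} {Gamma : formula V -> Prop} {phi} :
  denumerable V -> ~ proves Gamma phi ->
  exists Delta : formula V -> Prop,
    (forall a, Gamma a -> Delta a) /\ ~ proves Delta phi /\
    (forall a, ~ Delta a -> proves (add Delta a) phi).
Proof.
  intros HV Hphi.
  destruct (formula_code HV) as [c Hc].
  exists (fun a => exists n, lindenbaum c Gamma phi n a); split; [| split].
  - intros a Ha; now exists 0.
  - intros H; apply proves_chain_union in H as [n H]; [| now left].
    exact (lindenbaum_unprovable c n Hc Hphi H).
  - intros a Ha; apply NNPP; intros Hnot; apply Ha.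
    (* [a] is examined at stage [S (c a)]. A proof of [phi] from [a] and the previous stage would
       also be one from [a] and the union, so [a] gets added. *)
    exists (S (c a)); right; split; [reflexivity |].
    intros H; apply Hnot; revert H; apply proves_weaken.
    intros b [Hb | ->]; [left; eauto | now right].
Qed.

Section Maximal.

Context {V : Type} {Delta : formula V -> Prop} {phi : formula V}.
Hypothesis unprovable : ~ proves Delta phi.
Hypothesis maximal : forall a, ~ Delta a -> proves (add Delta a) phi.

(** If [a] were outside [Delta], maximality and the deduction theorem would give [a ⟶ phi], and
    [phi] would follow. *)
Lemma maximal_closed a : proves Delta a -> Delta a.
Proof.
  intros Ha; apply NNPP; intros Hna; apply unprovable.
  exact (proves_mp (deduction (maximal a Hna)) Ha).
Qed.

Lemma maximal_mp a b : Delta (a ⟶ b) -> Delta a -> Delta b.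
Proof.
  intros Hab Ha; apply maximal_closed.
  exact (proves_mp (proves_hyp Hab) (proves_hyp Ha)).
Qed.

Lemma maximal_axiom a : axiom a -> Delta a.
Proof.
  intros Ha; apply maximal_closed, proves_axiom, Ha.
Qed.

(** If both disjuncts were missing, each would imply [phi] by maximality, and [Ax8] would derive
    [phi] from the disjunction. *)
Lemma maximal_prime a b : Delta (a ∨' b) -> Delta a \/ Delta b.
Proof.
  intros Hab; apply NNPP; intros Hno; apply not_or_and in Hno as [Ha Hb].
  apply unprovable.
  exact (proves_mp (proves_mp (proves_mp (proves_axiom (Ax8 a b phi))
    (deduction (maximal a Ha))) (deduction (maximal b Hb))) (proves_hyp Hab)).
Qed.

Lemma maximal_valuation (v : formula V -> bool) :
  (forall a, v a = true <-> Delta a) -> valuation v.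
Proof.
  intros Hv.
  assert (Hf : forall a, v a = false <-> ~ Delta a).
  { intros a; rewrite <- Hv; destruct (v a); split; congruence. }
  split; intros a; intros; rewrite ?Hv, ?Hf in *.
  - split; [apply maximal_prime |].
    intros [H | H]; revert H; apply maximal_mp, maximal_axiom; constructor.
  - split.
    + intros H; split; revert H; apply maximal_mp, maximal_axiom; constructor.
    + intros [Ha Hb].
      exact (maximal_mp _ _ (maximal_mp _ _ (maximal_axiom _ (Ax3 a b)) Ha) Hb).
  - split.
    + intros Hab; destruct (classic (Delta a)) as [Ha |]; [right | now left].
      exact (maximal_mp _ _ Hab Ha).
    + intros [Ha | Hb].
      * destruct (maximal_prime _ _ (maximal_axiom _ (Ax9 a b))); tauto.
      * exact (maximal_mp _ _ (maximal_axiom _ (Ax1 b a)) Hb).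
  (* [Ax10] explodes to [phi] itself, the one formula known to be unprovable. *)
  - intros Hna; apply unprovable.
    exact (proves_mp (proves_mp (proves_axiom (Ax10 a phi)) (proves_hyp H))
      (proves_hyp Hna)).
  - destruct (maximal_prime _ _ (maximal_axiom _ (Ax11 a))) as [Ho |]; auto.
    apply maximal_prime in Ho; tauto.
Qed.

End Maximal.

Theorem theorem2p20 (V : Type) (HV : denumerable V)
    (Gamma : formula V -> Prop) (phi : formula V) :
  entails Gamma phi -> derives Gamma phi.
Proof.
  intros Hent; apply proves_derives, NNPP; intros Hphi.
  destruct (maximal_extension HV Hphi) as (Delta & Hsub & Hun & Hmax).
  (* Membership in [Delta] is undecided, so a boolean characteristic function takes informative
     excluded middle. *)
  pose (v := fun a => if excluded_middle_informative (Delta a) then true else false).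
  assert (Hv : forall a, v a = true <-> Delta a).
  { intros a; unfold v; destruct (excluded_middle_informative (Delta a));
      split; easy. }
  (* Entailment forces [v phi = true], hence [phi] lies in [Delta], which cannot prove it. *)
  apply Hun, proves_hyp, Hv, Hent.
  - exact (maximal_valuation Hun Hmax v Hv).
  - intros g Hg; apply Hv, Hsub, Hg.
Qed.
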